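(* Let $a<b$ be real numbers and let $f:[a,b]\to[a,b]$ be a Lipschitz and topologically transitive map with a fixed point $c\in[a,b]$. Consider $M=[a,b]$ with its usual metric $|\cdot|$ as a pointed metric space with base point $c$. Then the Lipschitz operator $\widehat{f}:\mathcal{F}(M)\to\mathcal{F}(M)$ is Devaney chaotic.
   Context: For a metric space $(M,d)$ with a distinguished base point (here $c$), $\mathrm{Lip}_0(M)$ is the real Banach space of Lipschitz functions $M\to\mathbb{R}$ vanishing at the base point, with norm the best Lipschitz constant. For $x\in M$, $\delta(x)\in \mathrm{Lip}_0(M)^*$ is the evaluation $\langle \varphi,\delta(x)\rangle=\varphi(x)$. The Lipschitz-free space is $\mathcal{F}(M)=\overline{\mathrm{span}}^{\|\cdot\|}\{\delta(x):x\in M\}\subset \mathrm{Lip}_0(M)^*$. If $f:M\to M$ is Lipschitz and fixes the base point, $\widehat{f}:\mathcal{F}(M)\to\mathcal{F}(M)$ is the unique bounded linear operator with $\widehat{f}(\delta(x))=\delta(f(x))$ for all $x\in M$. A continuous self-map $F$ of a metric space $X$ (in particular a bounded linear operator on a Banach space) is topologically transitive if for all nonempty open $U,V\subset X$ there is an integer $n\ge0$ with $F^n(U)\cap V\neq\emptyset$. $F$ is Devaney chaotic if it is topologically transitive and its set of periodic points (points $x$ with $F^n(x)=x$ for some $n\ge1$) is dense in $X$. *)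

(* Defs.v *)
From HB Require Import structures.
From mathcomp Require Import all_boot all_order all_algebra.
From mathcomp Require Import all_classical all_reals.
From mathcomp Require Import topology normedtype.

Set Implicit Arguments.
Unset Strict Implicit.
Unset Printing Implicit Defensive.

Import Order.TTheory GRing.Theory Num.Theory.
Import numFieldNormedType.Exports.

Local Open Scope classical_set_scope.
Local Open Scope ring_scope.

Definition topologically_transitive (X : topologicalType) (F : X -> X) :=
  forall U V : set X, open U -> U !=set0 -> open V -> V !=set0 ->
    exists n, (iter n F @` U) `&` V !=set0.

Definition periodic_points (X : Type) (F : X -> X) : set X :=
  [set x | exists2 n, (0 < n)%N & iter n F x = x].

Definition devaney_chaotic (X : topologicalType) (F : X -> X) :=
  topologically_transitive F /\ dense (periodic_points F).

(* The library only equips subsets of a pseudometric space with a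
   pseudometric. *)
Section set_type_metric.
Context {R : realType} {X : metricType R} (A : set X).

Let dist (x y : A) : R := mdist (set_val x) (set_val y).

Let dist_ge0 x y : 0 <= dist x y. Proof. exact: mdist_ge0. Qed.

Let dist_positivity x y : dist x y = 0 -> x = y.
Proof. by move/mdist_positivity => xy; exact: val_inj. Qed.

Let ballEdist (x : A) d : ball x d = [set y | dist x y < d].
Proof. by rewrite -[LHS]/(set_val @^-1` ball (set_val x) d) ballEmdist. Qed.

HB.instance Definition _ := @PseudoMetric_isMetric.Build R (set_type A)
  dist dist_ge0 dist_positivity ballEdist.

End set_type_metric.

(* [R^o] rather than [R] because it is [R^o] that carries the metric
   [`|y - x|] in the library. *)
Definition segment (R : realType) (a b : R) : metricType R :=
  set_type (`[a, b] : set R^o).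

Lemma mdist_segment (R : realType) (a b : R) (x y : segment a b) :
  mdist x y = `|set_val y - set_val x|.
Proof. by []. Qed.

Definition lipschitz_map (R : realType) (M N : metricType R) (f : M -> N) :=
  exists k : R, forall x y, mdist (f x) (f y) <= k * mdist x y.

(* The least [k] with [|g| <= k w]. Requiring [0 <= k] only matters when [w]
   vanishes identically (one-point metric space, zero normed space). *)
Definition best_const (R : realType) (I : Type) (g w : I -> R) : R :=
  inf [set k | 0 <= k /\ forall i, `|g i| <= k * w i].

Definition has_const (R : realType) (I : Type) (g w : I -> R) :=
  exists k : R, forall i, `|g i| <= k * w i.

Section best_const_theory.
Context {R : realType} {I : Type} {w : I -> R}.
Context (w0 : forall i, 0 <= w i).
Implicit Types g : I -> R.

Let K g := [set k : R | 0 <= k /\ forall i, `|g i| <= k * w i].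

Lemma best_const_ge0 g : 0 <= best_const g w.
Proof.
rewrite /best_const -/(K g).
have [->|/set0P K0] := eqVneq (K g) set0; first by rewrite inf0.
by apply: lb_le_inf => // k [].
Qed.

Let has_inf_K g : has_const g w -> has_inf (K g).
Proof.
move=> [k gk]; split; last by exists 0 => ? [].
exists `|k|; split=> // i; apply: le_trans (gk i) _.
by rewrite ler_wpM2r// ler_norm.
Qed.

Lemma best_constP g i : has_const g w -> `|g i| <= best_const g w * w i.
Proof.
move=> /has_inf_K infK; have [wi0|wi0] := eqVneq (w i) 0.
  by have [[k [_ gk]] _] := infK; have := gk i; rewrite !wi0 !mulr0.
have wi_gt0 : 0 < w i by rewrite lt_def wi0 w0.
rewrite -ler_pdivrMr//; apply: lb_le_inf => [|k [_ gk]]; first by case: infK.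
by rewrite ler_pdivrMr.
Qed.

Lemma best_const_le g k :
  0 <= k -> (forall i, `|g i| <= k * w i) -> best_const g w <= k.
Proof. by move=> k0 gk; apply: ge_inf; [exists 0 => ? [] | split]. Qed.

Lemma best_constD g h : has_const g w -> has_const h w ->
  best_const (fun i => g i + h i) w <= best_const g w + best_const h w.
Proof.
move=> gc hc; apply: best_const_le => [|i].
  by rewrite addr_ge0// best_const_ge0.
by rewrite mulrDl (le_trans (ler_normD _ _))// lerD// best_constP.
Qed.

Lemma best_constZ a g : has_const g w ->
  best_const (fun i => a * g i) w = `|a| * best_const g w.
Proof.
move=> gc.
have leZ b h : has_const h w ->
    best_const (fun i => b * h i) w <= `|b| * best_const h w.
  move=> hc; apply: best_const_le => [|i].
    by rewrite mulr_ge0// best_const_ge0.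
  by rewrite normrM -mulrA ler_wpM2l// best_constP.
apply/eqP; rewrite eq_le leZ//=.
have [->|a0] := eqVneq a 0; first by rewrite normr0 mul0r best_const_ge0.
have := @leZ a^-1 (fun i => a * g i).
under [X in best_const X]funext do rewrite mulKf//.
rewrite normfV -ler_pdivrMl ?invr_gt0 ?normr_gt0// invrK; apply.
case: gc => k gk; exists (`|a| * k) => i.
by rewrite normrM -mulrA ler_wpM2l.
Qed.

Lemma best_const0 g i : has_const g w -> best_const g w = 0 -> g i = 0.
Proof.
by move=> gc g0; apply/eqP; rewrite -normr_le0 (le_trans (best_constP i gc))//
  g0 mul0r.
Qed.

End best_const_theory.

Section lip0.
Context {R : realType} {M : metricType R}.

Definition lip0_pred (c : M) : {pred M -> R^o} :=
  [pred phi : M -> R^o | `[< lipschitz_map (N := R^o) phi /\ phi c = 0 >]].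

Record lip0 (c : M) := Lip0 {
  lip0_fun :> M -> R^o;
  lip0_funP : lip0_fun \in lip0_pred c }.

Variable c : M.

HB.instance Definition _ := [isSub for @lip0_fun c].
HB.instance Definition _ := [Choice of lip0 c by <:].

Let increment (phi : M -> R^o) (xy : M * M) : R := phi xy.2 - phi xy.1.
Let gap (xy : M * M) : R := mdist xy.1 xy.2.

Let lipschitzE (phi : M -> R^o) :
  lipschitz_map (N := R^o) phi <-> has_const (increment phi) gap.
Proof.
split=> -[k phik]; exists k; first by case=> x y; exact: phik.
by move=> x y; exact: (phik (x, y)).
Qed.

Fact lip0_submod_closed : submod_closed (lip0_pred c).
Proof.
split.
  apply/asboolP; split=> //; exists 0 => x y.
  by rewrite mul0r /mdist/= subrr normr0.
move=> a u v /asboolP[[k uk] uc] /asboolP[[l vl] vc]; apply/asboolP; split.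
  exists (`|a| * k + l) => x y.
  have -> : mdist ((a *: u + v) x) ((a *: u + v) y) =
      `|a * (u y - u x) + (v y - v x)|.
    by rewrite mulrBr addrACA -opprD.
  rewrite (le_trans (ler_normD _ _))// mulrDl lerD//; last exact: vl.
  by rewrite normrM -mulrA ler_wpM2l//; exact: uk.
by rewrite -[LHS]/(a * u c + v c) uc vc mulr0 addr0.
Qed.

HB.instance Definition _ :=
  GRing.isSubmodClosed.Build R (M -> R^o) (lip0_pred c) lip0_submod_closed.
HB.instance Definition _ := [SubChoice_isSubLmodule of lip0 c by <:].

Lemma lip0_lipschitz (phi : lip0 c) : lipschitz_map (N := R^o) phi.
Proof. by have /asboolP[] := lip0_funP phi. Qed.

Lemma lip0_base (phi : lip0 c) : phi c = 0.
Proof. by have /asboolP[] := lip0_funP phi. Qed.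


Let increment_const (phi : lip0 c) : has_const (increment phi) gap.
Proof. exact/lipschitzE/lip0_lipschitz. Qed.

Let gap_ge0 xy : 0 <= gap xy. Proof. exact: mdist_ge0. Qed.

(* [`|phi y - phi x|] is [mdist (phi x) (phi y)] for the metric of [R^o]. *)
Definition lip_norm (phi : lip0 c) : R :=
  best_const (fun xy : M * M => phi xy.2 - phi xy.1)
             (fun xy => mdist xy.1 xy.2).

Let lip_normD phi psi : lip_norm (phi + psi) <= lip_norm phi + lip_norm psi.
Proof.
have <- : best_const (fun xy => increment phi xy + increment psi xy) gap =
    lip_norm (phi + psi).
  by congr best_const; apply/funext => xy; rewrite /increment addrACA -opprD.
by apply: best_constD => //; exact: increment_const.
Qed.

Let lip_normZ (a : R) phi : lip_norm (a *: phi) = `|a| * lip_norm phi.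
Proof.
have <- : best_const (fun xy => a * increment phi xy) gap = lip_norm (a *: phi).
  by congr best_const; apply/funext => xy; rewrite /increment mulrBr.
by apply: best_constZ => //; exact: increment_const.
Qed.

Let lip_norm_eq0 phi : lip_norm phi = 0 -> phi = 0.
Proof.
move=> phi0; apply/val_inj/funext => x.
have := best_const0 gap_ge0 (c, x) (increment_const phi) phi0.
by rewrite /increment/= lip0_base subr0.
Qed.

HB.instance Definition _ :=
  Lmodule_isNormed.Build R (lip0 c) lip_normD lip_normZ lip_norm_eq0.

Lemma lip0_normP (phi : lip0 c) x y : `|phi y - phi x| <= `|phi| * mdist x y.
Proof. exact: (best_constP gap_ge0 (x, y) (increment_const phi)). Qed.

Lemma lip0_norm_le (phi : lip0 c) (k : R) : 0 <= k ->
  (forall x y, `|phi y - phi x| <= k * mdist x y) -> `|phi| <= k.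
Proof. by move=> k0 phik; apply: best_const_le => // -[x y]; exact: phik. Qed.

End lip0.

Section dual.
Context {R : realType}.

Definition dual_pred (V : normedModType R) : {pred V -> R^o} :=
  [pred l | `[< linear l /\ exists k : R, forall v, `|l v| <= k * `|v| >]].
Arguments dual_pred : clear implicits.

Record dual (V : normedModType R) := Dual {
  dual_fun :> V -> R^o;
  dual_funP : dual_fun \in dual_pred V }.

Variable V : normedModType R.

HB.instance Definition _ := [isSub for @dual_fun V].
HB.instance Definition _ := [Choice of dual V by <:].

Fact dual_submod_closed : submod_closed (dual_pred V).
Proof.
split.
  apply/asboolP; split; first by move=> a u v; rewrite scaler0 addr0.
  by exists 0 => v; rewrite mul0r normr0.
move=> a l m /asboolP[ll [j lj]] /asboolP[lm [k mk]]; apply/asboolP; split.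
  move=> b u v.
  rewrite -[LHS]/(a *: l (b *: u + v) + m (b *: u + v)) ll lm.
  rewrite -[RHS]/(b *: (a *: l u + m u) + (a *: l v + m v)).
  by rewrite !scalerDr !scalerA (mulrC a) addrACA.
exists (`|a| * j + k) => v.
rewrite -[X in `|X|]/(a * l v + m v) (le_trans (ler_normD _ _))// mulrDl lerD//.
by rewrite normrM -mulrA ler_wpM2l.
Qed.

HB.instance Definition _ :=
  GRing.isSubmodClosed.Build R (V -> R^o) (dual_pred V) dual_submod_closed.
HB.instance Definition _ := [SubChoice_isSubLmodule of dual V by <:].

Let dual_linear (l : dual V) : linear (l : V -> R^o).
Proof. by have /asboolP[] := dual_funP l. Qed.

HB.instance Definition _ (l : dual V) :=
  GRing.isLinear.Build R V R^o *:%R l (dual_linear l).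

Let dual_const (l : dual V) : has_const l (fun v : V => `|v|).
Proof. by have /asboolP[] := dual_funP l. Qed.

Definition dual_norm (l : dual V) : R := best_const l (fun v : V => `|v|).

Let dual_normD l m : dual_norm (l + m) <= dual_norm l + dual_norm m.
Proof. by apply: best_constD => //; exact: dual_const. Qed.

Let dual_normZ (a : R) l : dual_norm (a *: l) = `|a| * dual_norm l.
Proof. by apply: best_constZ => //; exact: dual_const. Qed.

Let dual_norm_eq0 l : dual_norm l = 0 -> l = 0.
Proof.
move=> l0; apply/val_inj/funext => v.
exact: (best_const0 (@normr_ge0 _ _) v (dual_const l) l0).
Qed.

HB.instance Definition _ :=
  Lmodule_isNormed.Build R (dual V) dual_normD dual_normZ dual_norm_eq0.

Lemma dual_normP (l : dual V) v : `|l v| <= `|l| * `|v|.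
Proof. exact: (best_constP (@normr_ge0 _ _) v (dual_const l)). Qed.

Lemma dual_norm_le (l : dual V) (k : R) : 0 <= k ->
  (forall v, `|l v| <= k * `|v|) -> `|l| <= k.
Proof. exact: best_const_le. Qed.

End dual.
Arguments dual_pred {R} V _.

Section lipfree.
Context {R : realType} {M : metricType R}.

Section delta.
Variable c : M.

Fact delta_subproof (x : M) :
  (fun phi : lip0 c => phi x : R^o) \in dual_pred (lip0 c).
Proof.
apply/asboolP; split=> //; exists (mdist c x) => phi.
by rewrite mulrC (le_trans _ (lip0_normP phi c x))// lip0_base subr0.
Qed.

Definition delta (x : M) : dual (lip0 c) := Dual (delta_subproof x).

Definition delta_span : set (dual (lip0 c)) :=
  [set m | exists n (a : 'I_n -> R) (x : 'I_n -> M),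
    m = \sum_(i < n) a i *: delta (x i)].

End delta.
Arguments delta_span c _ : clear implicits.

Definition lipfree_pred (c : M) : {pred dual (lip0 c)} :=
  [pred m | m \in closure (delta_span c)].

Arguments lipfree_pred c _ : clear implicits.

(* F(M), with the norm of the dual of Lip_0(M). *)
Record lipfree (c : M) := Lipfree {
  lipfree_val :> dual (lip0 c);
  lipfree_valP : lipfree_val \in lipfree_pred c }.

Variable c : M.

HB.instance Definition _ := [isSub for @lipfree_val c].
HB.instance Definition _ := [Choice of lipfree c by <:].

Lemma lipfree_predP (m : dual (lip0 c)) :
  m \in lipfree_pred c <->
  forall e : R, 0 < e -> exists2 s, delta_span c s & `|m - s| < e.
Proof.
split=> [|cl].
  rewrite !inE => cl e e0.
  have [s [ss mes]] := cl _ (nbhsx_ballx m e e0).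
  by exists s => //; move: mes; rewrite -ball_normE.
rewrite !inE => B /nbhs_ballP[e /= e0 eB].
have [s ss ms] := cl _ e0; exists s; split=> //.
by apply: eB; rewrite -ball_normE.
Qed.

Lemma delta_span0 : delta_span c 0.
Proof. by exists 0%N, (fun=> 0), (fun=> c); rewrite big_ord0. Qed.

Lemma delta_span_delta x : delta_span c (delta c x).
Proof. by exists 1%N, (fun=> 1), (fun=> x); rewrite big_ord1 scale1r. Qed.

Lemma delta_spanD (k : R) s t :
  delta_span c s -> delta_span c t -> delta_span c (k *: s + t).
Proof.
move=> [n [a [x ->]]] [p [b [y ->]]].
exists (n + p)%N,
  (fun i => match fintype.split i with inl j => k * a j | inr j => b j end),
  (fun i => match fintype.split i with inl j => x j | inr j => y j end).
rewrite big_split_ord/= scaler_sumr; congr (_ + _); apply: eq_bigr => i _.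
  by rewrite (unsplitK (inl i)) scalerA.
by rewrite (unsplitK (inr i)).
Qed.

Fact lipfree_submod_closed : submod_closed (lipfree_pred c).
Proof.
split.
  by apply/lipfree_predP => e e0; exists 0; rewrite ?subrr ?normr0//;
    exact: delta_span0.
move=> k l m /lipfree_predP lc /lipfree_predP mc; apply/lipfree_predP => e e0.
have k1 : 0 < `|k| + 1 by rewrite ltr_pwDr.
have e2 : 0 < e / 2 by rewrite divr_gt0.
have [s ss ls] := lc _ (divr_gt0 e2 k1); have [t tt mt] := mc _ e2.
exists (k *: s + t); first exact: delta_spanD.
rewrite opprD addrACA -scalerBr (splitr e) (le_lt_trans (ler_normD _ _))//.
rewrite ler_ltD// normrZ; move/ltW: ls; rewrite ler_pdivlMr//.
by apply: le_trans; rewrite mulrC ler_wpM2l// lerDl.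
Qed.

HB.instance Definition _ := GRing.isSubmodClosed.Build R (dual (lip0 c))
  (lipfree_pred c) lipfree_submod_closed.
HB.instance Definition _ := [SubChoice_isSubLmodule of lipfree c by <:].

Let lipfree_norm (m : lipfree c) : R := `|lipfree_val m|.

Let lipfree_normD l m :
  lipfree_norm (l + m) <= lipfree_norm l + lipfree_norm m.
Proof. exact: ler_normD. Qed.

Let lipfree_normZ (a : R) m : lipfree_norm (a *: m) = `|a| * lipfree_norm m.
Proof. exact: normrZ. Qed.

Let lipfree_norm_eq0 m : lipfree_norm m = 0 -> m = 0.
Proof. by move/normr0_eq0 => m0; exact: val_inj. Qed.

HB.instance Definition _ := Lmodule_isNormed.Build R (lipfree c)
  lipfree_normD lipfree_normZ lipfree_norm_eq0.

Lemma lipfree_normE (m : lipfree c) : `|m| = `|lipfree_val m|.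
Proof. by []. Qed.

Fact lipfree_delta_subproof x : delta c x \in lipfree_pred c.
Proof.
apply/lipfree_predP => e e0; exists (delta c x); last by rewrite subrr normr0.
exact: delta_span_delta.
Qed.

Definition lipfree_delta (x : M) : lipfree c :=
  Lipfree (lipfree_delta_subproof x).

End lipfree.
Arguments delta_span {R M} c _.
Arguments lipfree_pred {R M} c _.

Section lipfree_map.
Context {R : realType} {M : metricType R} {c : M} {f : M -> M}.
Context (f_lip : lipschitz_map f) (f_c : f c = c).

Fact lip0_comp_subproof (phi : lip0 c) :
  (fun x => phi (f x)) \in lip0_pred c.
Proof.
apply/asboolP; split; last by rewrite f_c lip0_base.
case: f_lip => k fk; exists (`|phi| * k) => x y.
by rewrite (le_trans (lip0_normP phi _ _))// -mulrA ler_wpM2l.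
Qed.

Definition lip0_comp (phi : lip0 c) : lip0 c := Lip0 (lip0_comp_subproof phi).

Fact dual_push_subproof (m : dual (lip0 c)) :
  (fun phi => m (lip0_comp phi)) \in dual_pred (lip0 c).
Proof.
apply/asboolP; split.
  move=> a u v; rewrite -linearP; congr (m _); exact: val_inj.
have [k fk] := f_lip; exists (`|m| * `|k|) => phi.
rewrite (le_trans (dual_normP m _))// -mulrA ler_wpM2l//.
apply: lip0_norm_le => [|x y]; first by rewrite mulr_ge0.
rewrite (le_trans (lip0_normP phi _ _))// (mulrC `|k|) -mulrA ler_wpM2l//.
by rewrite (le_trans (fk x y))// ler_wpM2r ?mdist_ge0// ler_norm.
Qed.

(* The adjoint of [phi |-> phi \o f]. *)
Definition dual_push (m : dual (lip0 c)) : dual (lip0 c) :=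
  Dual (dual_push_subproof m).

Lemma dual_push_linear : linear dual_push.
Proof. by move=> a u v; exact: val_inj. Qed.

HB.instance Definition _ := GRing.isLinear.Build R (dual (lip0 c))
  (dual (lip0 c)) *:%R dual_push dual_push_linear.

Lemma dual_push_delta x : dual_push (delta c x) = delta c (f x).
Proof. exact: val_inj. Qed.

Lemma dual_push_bounded :
  exists2 k : R, 0 < k & forall m, `|dual_push m| <= k * `|m|.
Proof.
have [k fk] := f_lip; have k1 : 0 < `|k| + 1 by rewrite ltr_pwDr.
exists (`|k| + 1) => // m.
apply: dual_norm_le => [|phi]; first by rewrite mulr_ge0// ltW.
rewrite (le_trans (dual_normP m _))// (mulrC (_ + 1)) -mulrA ler_wpM2l//.
apply: lip0_norm_le => [|x y]; first by rewrite mulr_ge0// ltW.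
rewrite (le_trans (lip0_normP phi _ _))// (mulrC (_ + 1)) -mulrA ler_wpM2l//.
rewrite (le_trans (fk x y))// ler_wpM2r ?mdist_ge0//.
by rewrite (le_trans (ler_norm _))// lerDl.
Qed.

Lemma dual_push_span s : delta_span c s -> delta_span c (dual_push s).
Proof.
move=> [n [a [x ->]]]; exists n, a, (f \o x).
by rewrite linear_sum; apply: eq_bigr => i _; rewrite linearZ/= dual_push_delta.
Qed.

Fact lipfree_map_subproof (m : lipfree c) :
  dual_push (lipfree_val m) \in lipfree_pred c.
Proof.
have [k k0 fk] := dual_push_bounded; apply/lipfree_predP => e e0.
have /lipfree_predP/(_ _ (divr_gt0 e0 k0)) [s ss ms] := lipfree_valP m.
exists (dual_push s); first exact: dual_push_span.
by rewrite -linearB (le_lt_trans (fk _))// mulrC -ltr_pdivlMr.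
Qed.

(* By [lipfree_map_linear], [lipfree_map_continuous], [lipfree_map_delta] and
   [lipfree_map_unique] below, this is the unique bounded linear operator on
   F(M) that sends [delta x] to [delta (f x)]. *)
Definition lipfree_map (m : lipfree c) : lipfree c :=
  Lipfree (lipfree_map_subproof m).

Lemma lipfree_map_linear : linear lipfree_map.
Proof. by move=> a u v; apply/val_inj; exact: dual_push_linear. Qed.

HB.instance Definition _ := GRing.isLinear.Build R (lipfree c) (lipfree c)
  *:%R lipfree_map lipfree_map_linear.

Lemma lipfree_map_delta x :
  lipfree_map (lipfree_delta c x) = lipfree_delta c (f x).
Proof. by apply/val_inj; exact: dual_push_delta. Qed.

Lemma lipfree_map_continuous : continuous lipfree_map.
Proof.
have [k k0 fk] := dual_push_bounded.
apply/bounded_linear_continuous/linear_boundedP; near=> r => m.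
rewrite (le_trans (fk m))// ler_wpM2r//; near: r.
by apply: nbhs_pinfty_ge; rewrite num_real.
Unshelve. all: by end_near. Qed.

Lemma lipfree_span (s : dual (lip0 c)) : delta_span c s ->
  exists n (a : 'I_n -> R) (x : 'I_n -> M),
    s = lipfree_val (\sum_(i < n) a i *: lipfree_delta c (x i)).
Proof.
move=> [n [a [x ->]]]; exists n, a, x.
by rewrite -[RHS]/(val _) raddf_sum.
Qed.

Lemma lipfree_map_unique (T : lipfree c -> lipfree c) :
  linear T -> continuous T ->
  (forall x, T (lipfree_delta c x) = lipfree_delta c (f x)) ->
  T = lipfree_map.
Proof.
move=> T_lin T_cont T_delta.
pose T' : {linear lipfree c -> lipfree c} :=
  HB.pack T (GRing.isLinear.Build _ _ _ _ _ T_lin).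
have bounded (S : {linear lipfree c -> lipfree c}) : continuous S ->
    exists2 k : R, 0 < k & forall m, `|S m| <= k * `|m|.
  move/linear_bounded_continuous/linear_boundedP/pinfty_ex_gt0 => [k k0 Sk].
  by exists k.
have [j j0 Tj] := bounded T' T_cont.
have [k k0 fk] := bounded lipfree_map lipfree_map_continuous.
apply/funext => m; apply/eqP; rewrite -subr_eq0 -normr_le0.
apply/ler_addgt0Pl => e e0; rewrite addr0.
have jk0 : 0 < j + k by rewrite addr_gt0.
have /lipfree_predP/(_ _ (divr_gt0 e0 jk0))[s0 ss ms] := lipfree_valP m.
have [n [a [x s0E]]] := lipfree_span ss; move: ms; rewrite {}s0E.
set s : lipfree c := \sum_(i < n) _ => ms.
have Ts : T' s = lipfree_map s.
  rewrite !linear_sum; apply: eq_bigr => i _.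
  by rewrite !linearZ /= T_delta lipfree_map_delta.
have -> : T m - lipfree_map m = T' (m - s) - lipfree_map (m - s).
  by rewrite (linearB T') (linearB lipfree_map) Ts
    opprD opprK addrA addrAC subrK.
rewrite (le_trans (ler_normB _ _))// (le_trans (lerD (Tj _) (fk _)))//.
by rewrite -mulrDl mulrC -ler_pdivlMr// ltW.
Qed.

End lipfree_map.

(* Main.v *)
(* The coordinate displacement [f^n x - x] is a cocycle in [n], and on an
   interval without periodic points the IVT forbids it to change sign; a
   transitive [f] makes points of such an interval return both to the left and
   to the right, so periodic points of [f] are dense. Hence the vectors
   [sum a_i delta(p_i)] with [p_i] periodic are dense in F(M), and they are
   periodic for the operator T. Moreover, each of them is approximated by
   vectors [m] with [T^n m] small, for suitable large [n] in the multiples of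
   any prescribed period: move each [p_i] slightly to a point that [f^n] sends
   close to the base point, where [delta] vanishes. Transitivity follows: given
   such vectors [u] and [v], choose [m] close to [u - v] with [T^n m] small and
   [T^n v = v]; then [m + v] is close to [u] and [T^n (m + v)] is close to
   [v]. *)
Require Import Defs.
From mathcomp Require Import all_boot all_order all_algebra.
From mathcomp Require Import all_classical all_reals.
From mathcomp Require Import topology normedtype.
From mathcomp Require Import ring lra.

Import Order.TTheory GRing.Theory Num.Theory.
Import numFieldNormedType.Exports.

Local Open Scope ring_scope.

Lemma iter_dvdn {T : Type} {f : T -> T} {x : T} {m n : nat} :
  iter m f x = x -> (m %| n)%N -> iter n f x = x.
Proof.
move=> fx /dvdnP[k ->]; elim: k => //= k IH.
by rewrite mulSn iterD IH.
Qed.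

(** * Iterates of Lipschitz and transitive maps on metric spaces *)

Section transitive_maps.
Context {R : realType} {M : metricType R}.
Implicit Types f : M -> M.

Lemma lipschitz_map_ge1 f : lipschitz_map f ->
  exists2 k : R, 1 <= k & forall x y, mdist (f x) (f y) <= k * mdist x y.
Proof.
case=> k fk; exists (`|k| + 1) => [|x y]; first by rewrite lerDr.
rewrite (le_trans (fk x y))// ler_wpM2r ?mdist_ge0//.
by rewrite (le_trans (ler_norm _))// lerDl.
Qed.

Lemma lipschitz_map_iter f N : lipschitz_map f ->
  exists2 k : R, 0 < k &
    forall n, (n <= N)%N ->
      forall x y, mdist (iter n f x) (iter n f y) <= k * mdist x y.
Proof.
move=> /lipschitz_map_ge1[k k1 fk]; have k0 : 0 < k := lt_le_trans ltr01 k1.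
(* As [1 <= k], the largest power bounds all iterates up to [N] at once. *)
exists (k ^+ N) => [|n nN x y]; first exact: exprn_gt0.
apply: (@le_trans _ _ (k ^+ n * mdist x y)); last first.
  by rewrite ler_wpM2r ?mdist_ge0// ler_weXn2l.
elim: n {nN} => [|n IH]; first by rewrite expr0 mul1r.
by rewrite (le_trans (fk _ _))// exprS -mulrA ler_pM2l.
Qed.

Lemma transitive_mdist f p q (e d : R) : topologically_transitive f ->
  0 < e -> 0 < d ->
  exists n x, mdist p x < e /\ mdist q (iter n f x) < d.
Proof.
move=> ft e0 d0.
have ne (r : M) (s : R) : 0 < s -> ((ball r s)° r)%classic.
  by move=> s0; exact: nbhsx_ballx.
have [||n [y [[x px <-] qx]]] :=
  ft _ _ (open_interior (ball p e)) _ (open_interior (ball q d)).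
- by exists p; exact: ne.
- by exists q; exact: ne.
exists n, x; split.
  by have := interior_subset px; rewrite ballEmdist.
by have := interior_subset qx; rewrite ballEmdist.
Qed.

(* Waiting until time a multiple of [k] costs at most [k] further steps, and
   those move points near [c] little since [c] is fixed. *)
Lemma transitive_multiple f c p k (e d : R) : lipschitz_map f ->
  topologically_transitive f -> f c = c -> (0 < k)%N -> 0 < e -> 0 < d ->
  exists n x, mdist p x < e /\ mdist c (iter (k * n) f x) < d.
Proof.
move=> fl ft fc k0 e0 d0; have [j j0 fj] := lipschitz_map_iter f k fl.
have [n [x [px cx]]] := transitive_mdist f p c _ _ ft e0 (divr_gt0 d0 j0).
(* [r] more steps lead from time [n] to the next multiple of [k]; as [r <= k], they expand distances
   at most by the factor [j]. *)
pose r := (k - n %% k)%N.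
exists (n %/ k).+1, x; split=> //.
have -> : (k * (n %/ k).+1 = r + n)%N.
  have nk := ltnW (ltn_pmod n k0).
  by rewrite {2}(divn_eq n k) addnCA /r (subnK nk) mulnSr mulnC.
rewrite iterD.
have {1}-> : c = iter r f c by elim: (r) => //= m <-.
rewrite (le_lt_trans (fj _ _ _ _))// ?leq_subr//.
by rewrite mulrC -ltr_pdivlMr.
Qed.

End transitive_maps.

(** * Interval maps: intermediate values and periodic points *)

Section interval.
Context {R : realType} {a b : R}.
Implicit Types (x y z w p q : segment a b) (f : segment a b -> segment a b).

Definition coord x : R := set_val x.

Lemma mdist_coord x y : mdist x y = `|coord y - coord x|.
Proof. exact: mdist_segment. Qed.

Lemma coord_inj : injective coord.
Proof. exact: val_inj. Qed.

Lemma coord_bound x : a <= coord x <= b.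
Proof. by have := set_valP x; rewrite /= in_itv. Qed.

Lemma coord_ex t : a <= t <= b -> exists x, coord x = t.
Proof. by move=> tab; exists (SigSub (mem_set (tab : `[a, b]%classic t))). Qed.

Lemma segment_IVT (h : segment a b -> R) x y t :
  (exists k, forall x y, `|h x - h y| <= k * mdist x y) ->
  coord x <= coord y -> Num.min (h x) (h y) <= t <= Num.max (h x) (h y) ->
  exists2 w, coord x <= coord w <= coord y & h w = t.
Proof.
move=> [k hk] xy.
(* [g] clamps a real to the range from [coord x] to [coord y]; it is 1-Lipschitz, so [h \o g] is
   continuous on the whole line, where the real IVT applies. *)
have /choice[g gE] s :
    exists w, coord w = Num.max (coord x) (Num.min (coord y) s).
  apply: coord_ex; have := coord_bound x; have := coord_bound y.
  by rewrite ge_max le_max ge_min => /andP[_ ->] /andP[-> ->].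
have gK w : coord x <= coord w <= coord y -> g (coord w) = w.
  move=> /andP[xw wy]; apply: coord_inj; rewrite gE.
  by rewrite (min_idPr wy) (max_idPr xw).
have xx : coord x <= coord x <= coord y by rewrite lexx.
have yy : coord x <= coord y <= coord y by rewrite lexx andbT.
have hg_cont : continuous (h \o g : R -> R).
  move=> s; apply/cvgrPdist_lt => e e0.
  have k1 : 0 < `|k| + 1 by rewrite ltr_wpDl.
  near=> r; rewrite (le_lt_trans (hk _ _))//.
  have le1 : mdist (g s) (g r) <= `|s - r|.
    rewrite mdist_coord !gE ler_norml.
    have := ler_norm (s - r); have := ler_norm (r - s); rewrite (distrC r s).
    case: (lerP (coord y) s) => ?; case: (lerP (coord y) r) => ?;
      rewrite ?(max_idPr xy) //; case: (lerP (coord x) r) => ?;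
      case: (lerP (coord x) s) => ?; lra.
  apply: (@le_lt_trans _ _ ((`|k| + 1) * `|s - r|)).
    rewrite (@le_trans _ _ ((`|k| + 1) * mdist (g s) (g r)))//.
      rewrite ler_wpM2r ?mdist_ge0// (le_trans (ler_norm _))// lerDl//.
    by rewrite ler_pM2l.
  rewrite mulrC -ltr_pdivlMr//; near: r.
  exact: (nbhsx_ballx s _ (divr_gt0 e0 k1)).
have {1 2}<- := gK _ xx; have {1 2}<- := gK _ yy.
move=> /(@IVT R (h \o g) _ _ t xy (continuous_subspaceT hg_cont))[s].
rewrite in_itv => /= /andP[xs sy] hs; exists (g s) => //.
by rewrite gE (min_idPr sy) (max_idPr xs) xs.
Unshelve. all: by end_near. Qed.

(* For [s = 0] this finds preimages under [f^n], for [s = 1] and [t = 0] fixed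
   points of [f^n]. *)
Lemma segment_IVT_iter f n (s : R) x y t : lipschitz_map f ->
  coord (iter n f x) - s * coord x <= t ->
  t <= coord (iter n f y) - s * coord y ->
  exists2 w, coord (iter n f w) - s * coord w = t &
    coord x <= coord w <= coord y \/ coord y <= coord w <= coord x.
Proof.
move=> fl xt ty; pose h w := coord (iter n f w) - s * coord w.
have hl : exists k, forall x y, `|h x - h y| <= k * mdist x y.
  have [k k0 fk] := lipschitz_map_iter f n fl; exists (k + `|s|) => p q.
  have -> : h p - h q = (coord (iter n f p) - coord (iter n f q))
      - s * (coord p - coord q) by rewrite /h; ring.
  rewrite (le_trans (ler_normB _ _))// mulrDl normrM.
  rewrite [in X in _ <= _ + X]mdist_coord distrC -mdist_coord lerD ?fk//.
  by rewrite distrC.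
have [xy|/ltW yx] := leP (coord x) (coord y).
  have [|w xwy hw] := segment_IVT h x y t hl xy; last by exists w => //; left.
  by rewrite ge_min xt le_max ty orbT.
have [|w ywx hw] := segment_IVT h y x t hl yx; last by exists w => //; right.
by rewrite ge_min [h x <= t]xt le_max [t <= h y]ty orbT.
Qed.

Section no_periodic_point.
Context {f} (f_lip : lipschitz_map f) {u v : R}.
Context (nper : forall x, u < coord x < v -> ~ periodic_points f x).

Let shift n x := coord (iter n f x) - coord x.

(** A sign change would give a zero of [shift n] between [x] and [y], hence a periodic point in the
    forbidden interval. *)
Let shift_sign n x y : (0 < n)%N -> u < coord x < v -> u < coord y < v ->
  0 < shift n x -> 0 < shift n y.
Proof.
move=> n0 xJ yJ sx; rewrite ltNge; apply/negP => sy.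
have [||w w0 wxy] := segment_IVT_iter f n 1 y x 0 f_lip.
- by rewrite mul1r.
- by rewrite mul1r ltW.
apply: (nper w); first by case: wxy; lra.
by exists n => //; apply: coord_inj; lra.
Qed.

(* [shift] is a cocycle, and by [shift_sign] it has the same sign at [x] and
   at [f^m x]; hence the signs of the summands agree. *)
Let shift_mul m k x : (0 < m)%N -> u < coord x < v ->
  u < coord (iter m f x) < v ->
  (0 < shift m x -> 0 < shift (k.+1 * m) x) /\
  (shift m x < 0 -> shift (k.+1 * m) x < 0).
Proof.
move=> m0 xJ mxJ; elim: k => [|k [IHp IHn]]; first by rewrite mul1n.
have km0 : (0 < k.+1 * m)%N by rewrite muln_gt0.
have shiftD : shift (k.+2 * m) x = shift (k.+1 * m) (iter m f x) + shift m x.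
  by rewrite /shift mulSn addnC iterD; ring.
rewrite shiftD; split=> sx.
  by rewrite addr_gt0//; apply: (shift_sign _ x) => //; exact: IHp.
(* [shift_sign] transports only positivity: at [iter m f x] a positive shift would pass back to [x],
   against [IHn], and a zero shift would make that point periodic. *)
have := IHn sx; have := shift_sign _ _ _ km0 mxJ xJ.
have : shift (k.+1 * m) (iter m f x) != 0.
  apply/eqP => /eqP; rewrite subr_eq0 => /eqP/coord_inj ?.
  by apply: (nper (iter m f x)) => //; exists (k.+1 * m)%N.
by rewrite neq_lt => /orP[] ?; lra.
Qed.

(** Otherwise, at the common time [m * n], [x] would move right and [y] left, against
    [shift_sign]. *)
Lemma no_periodic_point_shift m n x y : u < coord x < v -> u < coord y < v ->
  u < coord (iter m f x) < v -> u < coord (iter n f y) < v ->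
  coord x < coord (iter m f x) -> coord y <= coord (iter n f y).
Proof.
move=> xJ yJ mxJ nyJ sx; rewrite leNgt; apply/negP => sy.
case: m => [|m] in mxJ sx *; first by rewrite ltxx in sx.
case: n => [|n] in nyJ sy *; first by rewrite ltxx in sy.
have [+ _] := shift_mul m.+1 n x isT xJ mxJ.
have [_ +] := shift_mul n.+1 m y isT yJ nyJ.
rewrite /shift !subr_lt0 !subr_gt0 mulnC => /(_ sy) ny /(_ sx).
rewrite -subr_gt0 => /(shift_sign (n.+1 * m.+1) _ _ isT xJ yJ).
by rewrite subr_gt0 => /lt_trans/(_ ny); rewrite ltxx.
Qed.

End no_periodic_point.

Lemma transitive_periodic_between f (u v : R) : lipschitz_map f ->
  topologically_transitive f -> a <= u -> u < v -> v <= b ->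
  exists2 x, periodic_points f x & u < coord x < v.
Proof.
move=> fl ft au uv vb; apply/not_exists2P => nper.
have {}nper x : u < coord x < v -> ~ periodic_points f x.
  by move=> ux px; have [] := nper x.
(* The balls of radius [r] around [u + r * 2] and [u + r * 4] are disjoint and inside the interval,
   so passing from the first to the second moves right, and passing back moves left. *)
pose r := (v - u) / 6.
have r0 : 0 < r by rewrite /r; lra.
have [p pE] : exists p, coord p = u + r * 2 by apply: coord_ex; rewrite /r; lra.
have [q qE] : exists q, coord q = u + r * 4 by apply: coord_ex; rewrite /r; lra.
have [m [x [+ +]]] := transitive_mdist f p q _ _ ft r0 r0.
have [n [y [+ +]]] := transitive_mdist f q p _ _ ft r0 r0.
rewrite !mdist_coord pE qE !ltr_norml => yq ny xp mx.
have := no_periodic_point_shift fl nper m n x y.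
rewrite /r in yq ny xp mx *.
have -> : u < coord x < v by lra.
have -> : u < coord y < v by lra.
have -> : u < coord (iter m f x) < v by lra.
have -> : u < coord (iter n f y) < v by lra.
by move=> /(_ isT isT isT isT); lra.
Qed.

(* A periodic [q] strictly between [p] and [c] lies in [f^(kn)(ball p e)] for
   one [n] by the IVT, hence for all larger [n] if [k] is a multiple of its
   period. *)
Lemma transitive_hit_fixed_point f c p (e d : R) : lipschitz_map f ->
  topologically_transitive f -> f c = c -> periodic_points f p ->
  0 < e -> 0 < d ->
  exists2 D, (0 < D)%N & forall k, (0 < k)%N -> (D %| k)%N ->
    exists N, forall n, (N <= n)%N ->
      exists x, mdist p x < e /\ mdist c (iter (k * n) f x) < d.
Proof.
move=> fl ft fc [i i0 fp] e0 d0.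
have [pd|dp] := ltP (mdist c p) d.
  exists i => // k k0 ik; exists 0%N => n _; exists p.
  by rewrite mdistxx (iter_dvdn fp)// dvdn_mulr.
(* Since [p] is at least [d] away from [c], there is room for [q] within [d] of [c] on the side of
   [p]. *)
have [q [j j0 fq] [cq qbetw]] : exists2 q, periodic_points f q &
    mdist c q < d /\
    (coord c < coord q < coord p \/ coord p < coord q < coord c).
  have cab := coord_bound c; have pab := coord_bound p.
  move: dp; rewrite mdist_coord ler_normr => /orP[] dp.
    have [|||q fq qc] :=
      transitive_periodic_between f (coord c) (coord c + d) fl ft; [lra..|].
    by exists q => //; split; [rewrite mdist_coord ltr_norml|left]; lra.
  have [|||q fq qc] :=
    transitive_periodic_between f (coord c - d) (coord c) fl ft; [lra..|].
  by exists q => //; split; [rewrite mdist_coord ltr_norml|right]; lra.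
exists (i * j)%N => [|k k0 ijk]; first by rewrite muln_gt0 i0.
have qc0 : 0 < mdist c q.
  by rewrite mdist_gt0; apply/eqP => cqE; case: qbetw; rewrite cqE; lra.
(* At time [k * N] the image of [x] is closer to [c] than [q] is, while [p] returns to itself beyond
   [q]; so some [w] between [x] and [p] is sent to [q]. *)
have [N [x [px cx]]] := transitive_multiple f c p k e _ fl ft fc k0 e0 qc0.
have fpN : iter (k * N) f p = p.
  by rewrite (iter_dvdn fp)// dvdn_mulr// (dvdn_trans _ ijk)// dvdn_mulr.
have [w wq wpx] : exists2 w, iter (k * N) f w = q &
    coord x <= coord w <= coord p \/ coord p <= coord w <= coord x.
  move: cx; rewrite !mdist_coord ltr_norml => cx.
  case: qbetw => cqp.
    move: cx; rewrite ger0_norm ?subr_ge0; last by lra.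
    move=> cx; have [||w wq wpx] :=
      segment_IVT_iter f (k * N) 0 x p (coord q) fl.
    - by rewrite mul0r; lra.
    - by rewrite fpN; lra.
    exists w => //; apply: coord_inj; lra.
  move: cx; rewrite ler0_norm ?subr_le0; last by lra.
  move=> cx; have [||w wq wpx] :=
    segment_IVT_iter f (k * N) 0 p x (coord q) fl.
  - by rewrite fpN; lra.
  - by rewrite mul0r; lra.
  by exists w; [apply: coord_inj; lra | case: wpx; [right|left]].
exists N => n Nn; exists w; split.
  move: px; rewrite !mdist_coord !ltr_norml; case: wpx; lra.
rewrite -(subnK Nn) mulnDr iterD wq (iter_dvdn fq)// dvdn_mulr//.
by rewrite (dvdn_trans _ ijk)// dvdn_mull.
Qed.

End interval.

(** * A chaos criterion for linear operators on normed spaces *)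

Section linear_chaos.
Context {R : realType} {V : normedModType R}.
Implicit Types (S : set V) (T : {linear V -> V}) (u v m : V).

Definition norm_dense S :=
  forall u (e : R), 0 < e -> exists2 s, S s & `|u - s| < e.

Lemma iter_linear T n : linear (iter n T).
Proof. by move=> k u v; elim: n => //= n ->; rewrite linearP. Qed.

Lemma periodic_points_linear T k u v :
  periodic_points T u -> periodic_points T v -> periodic_points T (k *: u + v).
Proof.
move=> [i i0 iu] [j j0 jv]; exists (i * j)%N; first by rewrite muln_gt0 i0.
by rewrite iter_linear (iter_dvdn iu) ?dvdn_mulr// (iter_dvdn jv)// dvdn_mull.
Qed.

(* Quantifying over all multiples [k] of some [D] makes the property stable
   under linear combinations and leaves room for the period of another
   vector. *)
Definition eventually_small T u := forall e : R, 0 < e ->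
  exists2 D, (0 < D)%N & forall k, (0 < k)%N -> (D %| k)%N ->
    exists N, forall n, (N <= n)%N ->
      exists2 m, `|u - m| < e & `|iter (k * n) T m| < e.

(** The product of the two moduli and the larger of the two thresholds make both approximations
    available at the same times. *)
Lemma eventually_small_linear T k u v :
  eventually_small T u -> eventually_small T v ->
  eventually_small T (k *: u + v).
Proof.
move=> us vs e e0.
have k1 : 0 < `|k| + 1 by rewrite ltr_wpDl.
have e2 : 0 < e / 2 by rewrite divr_gt0.
have [D D0 uD] := us _ (divr_gt0 e2 k1); have [E E0 vE] := vs _ e2.
exists (D * E)%N => [|j j0 DEj]; first by rewrite muln_gt0 D0.
have [N uN] := uD j j0 (dvdn_trans (dvdn_mulr _ (dvdnn _)) DEj).
have [P vP] := vE j j0 (dvdn_trans (dvdn_mull _ (dvdnn _)) DEj).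
exists (maxn N P) => n; rewrite geq_max => /andP[/uN[m um Tm] /vP[l vl Tl]].
have small x y : `|x| < e / 2 / (`|k| + 1) -> `|y| < e / 2 -> `|k *: x + y| < e.
  move=> xe ye; rewrite (splitr e) (le_lt_trans (ler_normD _ _))//.
  rewrite ler_ltD// normrZ; move/ltW: xe; rewrite ler_pdivlMr//.
  by apply: le_trans; rewrite mulrC ler_wpM2l// lerDl.
exists (k *: m + l); last by rewrite iter_linear small.
by rewrite opprD addrACA -scalerBr small.
Qed.

Lemma norm_dense_dense S : norm_dense S -> dense S.
Proof.
move=> Sd O [u Ou] Oo.
have /nbhs_ballP[e /= e0 eO] := open_nbhs_nbhs (conj Oo Ou).
have [s Ss us] := Sd u e e0; exists s; split=> //.
by apply: eO; rewrite -ball_normE.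
Qed.

Lemma devaney_chaotic_linear T S : norm_dense S ->
  (forall u v, S u -> S v -> S (u - v)) ->
  (forall u, S u -> periodic_points T u) ->
  (forall u, S u -> eventually_small T u) -> devaney_chaotic T.
Proof.
move=> Sd SB Sper Ssmall; split; last first.
  apply: norm_dense_dense => u e e0; have [s Ss us] := Sd u e e0.
  by exists s => //; exact: Sper.
move=> U W Uo [u0 Uu0] Wo [w0 Ww0].
have [s [Ss Us]] : exists s, S s /\ U s.
  have [|s [Us Ss]] := norm_dense_dense S Sd U _ Uo; first by exists u0.
  by exists s.
have [t [St Wt]] : exists t, S t /\ W t.
  have [|t [Wt St]] := norm_dense_dense S Sd W _ Wo; first by exists w0.
  by exists t.
have /nbhs_ballP[e /= e0 eU] := open_nbhs_nbhs (conj Uo Us).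
have /nbhs_ballP[d /= d0 dW] := open_nbhs_nbhs (conj Wo Wt).
have ed0 : 0 < Num.min e d by rewrite lt_min e0.
have [D D0 sD] := Ssmall _ (SB s t Ss St) _ ed0.
have [j j0 tj] := Sper _ St.
(* The factor [D] gives access to the smallness for [s - t]; the factor [j], a period of [t], makes
   the iterate fix [t]. *)
have Dj0 : (0 < D * j)%N by rewrite muln_gt0 D0.
have [N /(_ N (leqnn N))[m sm Tm]] := sD _ Dj0 (dvdn_mulr _ (dvdnn _)).
move: sm Tm; rewrite !lt_min => /andP[sm _] /andP[_ Tm].
exists (D * j * N)%N, (iter (D * j * N) T (m + t)); split.
  exists (m + t) => //; apply: eU; rewrite -ball_normE/=.
  by rewrite opprD addrA addrAC.
apply: dW; rewrite -ball_normE/= -[m]scale1r iter_linear scale1r.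
rewrite (iter_dvdn tj); last by rewrite dvdn_mulr// dvdn_mull.
by rewrite opprD addrCA subrr addr0 normrN.
Qed.

End linear_chaos.

(** * Evaluations and dense subspaces in the free space *)

Section lipfree.
Context {R : realType} {M : metricType R} {c : M}.

Lemma lipfree_delta_dist (x y : M) :
  `|lipfree_delta c x - lipfree_delta c y| <= mdist x y.
Proof.
apply: dual_norm_le => [|phi]; first exact: mdist_ge0.
by rewrite mulrC metric_sym; exact: lip0_normP.
Qed.

Lemma lipfree_delta_base : lipfree_delta c c = 0.
Proof. by apply/val_inj/val_inj/funext => phi; exact: lip0_base. Qed.

(** Finite combinations of evaluations are dense by construction, and moving their points one at a
    time changes the norm little, as [lipfree_delta] is 1-Lipschitz. *)
Lemma lipfree_norm_dense (S : set (lipfree c)) : S 0 ->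
  (forall k u v, S u -> S v -> S (k *: u + v)) ->
  (forall x (e : R), 0 < e ->
    exists2 y, S (lipfree_delta c y) & mdist x y < e) ->
  norm_dense S.
Proof.
move=> S0 Slin Sdelta m e e0; have e2 : 0 < e / 2 by rewrite divr_gt0.
have /lipfree_predP/(_ _ e2)[s0 ss ms] := lipfree_valP m.
have [n [a [x s0E]]] := lipfree_span ss; move: ms; rewrite {}s0E {ss s0}.
set s : lipfree c := \sum_(i < n) _ => ms.
have [t St ts] : exists2 t, S t & `|s - t| < e / 2.
  rewrite {}/s in ms *; elim: n a x (e / 2) e2 {ms} => [|n IH] a x d d0.
    by exists 0 => //; rewrite big_ord0 subrr normr0.
  have d2 : 0 < d / 2 by rewrite divr_gt0.
  have k1 : 0 < `|a ord0| + 1 by rewrite ltr_wpDl.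
  have [t St std] :=
    IH (fun i => a (lift ord0 i)) (fun i => x (lift ord0 i)) _ d2.
  have [y Sy xy] := Sdelta (x ord0) _ (divr_gt0 d2 k1).
  exists (a ord0 *: lipfree_delta c y + t); first exact: Slin.
  rewrite big_ord_recl opprD addrACA -scalerBr (splitr d).
  rewrite (le_lt_trans (ler_normD _ _))// ler_ltD// normrZ.
  move/ltW: (le_lt_trans (lipfree_delta_dist _ _) xy); rewrite ler_pdivlMr//.
  by apply: le_trans; rewrite mulrC ler_wpM2l// lerDl.
exists t => //.
rewrite -(subrK s m) -addrA (splitr e) (le_lt_trans (ler_normD _ _))//.
by rewrite ltrD.
Qed.

Lemma iter_lipfree_map_delta (f : M -> M) (f_lip : lipschitz_map f)
    (f_c : f c = c) n x :
  iter n (lipfree_map f_lip f_c) (lipfree_delta c x) =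
  lipfree_delta c (iter n f x).
Proof. by elim: n => //= n ->; rewrite lipfree_map_delta. Qed.

End lipfree.

(** * The operator induced on the free space of an interval *)

Theorem corollary4p3 (R : realType) (a b : R) (ab : a < b)
    (f : segment a b -> segment a b) (f_lip : lipschitz_map f)
    (f_trans : topologically_transitive f)
    (c : segment a b) (f_c : f c = c) :
  devaney_chaotic (lipfree_map f_lip f_c).
Proof.
set T := lipfree_map f_lip f_c.
pose S : set (lipfree c) :=
  [set m | periodic_points T m /\ eventually_small T m]%classic.
have Slin k u v : S u -> S v -> S (k *: u + v).
  by move=> [pu su] [pv sv]; split;
    [exact: periodic_points_linear | exact: eventually_small_linear].
have Sdelta p : periodic_points f p -> S (lipfree_delta c p).
  move=> fp; split.
    by case: fp => n n0 fp; exists n => //; rewrite iter_lipfree_map_delta fp.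
  move=> e e0.
  have [D D0 pD] :=
    transitive_hit_fixed_point f c p e e f_lip f_trans f_c fp e0 e0.
  exists D => // k k0 Dk; have [N pN] := pD k k0 Dk.
  exists N => n /pN[x [px cx]].
  exists (lipfree_delta c x).
    exact: le_lt_trans (lipfree_delta_dist _ _) px.
  (* As [lipfree_delta c c = 0], the norm of an evaluation is at most the distance of its point to
     [c]. *)
  rewrite iter_lipfree_map_delta -[X in `|X|]subr0 -lipfree_delta_base.
  by rewrite (le_lt_trans (lipfree_delta_dist _ _))// metric_sym.
apply: (@devaney_chaotic_linear _ _ _ S) => [|u v Su Sv|u []//|u []//];
  last first.
  by rewrite addrC -scaleN1r; exact: Slin.
apply: lipfree_norm_dense => // [|x e e0].
  by rewrite -lipfree_delta_base; apply: Sdelta; exists 1%N.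
(* A one-sided interval next to [x] stays inside the segment: on the right unless [x] is the
   endpoint [b], and then on the left, where [a < b] leaves room. *)
have [u [v [au uv vb xuv]]] : exists u v, [/\ a <= u, u < v, v <= b &
    forall y : segment a b, u < coord y < v -> mdist x y < e].
  have xab := coord_bound x.
  have [xb|bx] := ltP (coord x) b.
    exists (coord x), (Num.min b (coord x + e)).
    split; rewrite ?lt_min ?ge_min ?lexx//; try lra.
    by move=> y; rewrite lt_min mdist_coord ltr_norml; lra.
  exists (Num.max a (coord x - e)), (coord x).
  split; rewrite ?gt_max ?le_max ?lexx//; try lra.
  by move=> y; rewrite gt_max mdist_coord ltr_norml; lra.
have [y fy yuv] := transitive_periodic_between f u v f_lip f_trans au uv vb.
by exists y; [exact: Sdelta | exact: xuv].
Qed.
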